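(* The adjacency eigenvalues of an $s$-loose cycle $C^{(m)}_{L(s;n)}$ are (1) when $m=2s$: $\dfrac{-2}{2s-1}$ with multiplicity $n(s-1)$, and $\dfrac{2}{2s-1}\Big(s-1+s\cos\dfrac{2\pi i}{n}\Big)$ with multiplicity one, for $i=1,2,\dots,n$; (2) when $m\ge 2s+1$: $\dfrac{-1}{m-1}$ with multiplicity at least $n(m-2s-1)$, $\dfrac{-2}{m-1}$ with multiplicity at least $n(s-1)$, and $\gamma_i^{+}$, $\gamma_i^{-}$ with multiplicity at least one, for $i=1,2,\dots,n$, where $$\gamma_i^{\pm}=\frac12\Bigg[m-3+2s\cos\frac{2\pi i}{n}\pm\sqrt{\Big(m-3+2s\cos\frac{2\pi i}{n}\Big)^2+8\Big(m-s-1+s\cos\frac{2\pi i}{n}\Big)}\Bigg].$$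
   Context: The $s$-loose cycle $C^{(m)}_{L(s;n)}$ is the unweighted $m$-uniform hypergraph with vertex set $\{1,2,\dots,n(m-s)\}$ and with the $n$ edges $\{i(m-s)+1,i(m-s)+2,\dots,i(m-s)+m\}$, $i=0,1,\dots,n-1$, where vertex labels are read modulo $n(m-s)$ (so cyclically consecutive edges share $s$ vertices). The adjacency matrix of an unweighted $m$-uniform hypergraph is the matrix indexed by its vertices with zero diagonal and with $(i,j)$ entry, for $i\ne j$, equal to $\frac{1}{m-1}$ times the number of edges containing both $i$ and $j$. The adjacency eigenvalues of a hypergraph are the eigenvalues of its adjacency matrix.
   Formalization: In (2) the eigenvalues are γ_i^± divided by m−1: without this factor the claim is false (m=3, s=1, i=n gives 1+√5 > 2, the largest row sum). Also s ≥ 1, with n ≥ 3 in (1) and n ≥ 2 in (2), so that the n edges are distinct m-sets. *)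

(* Defs.v *)
From HB Require Import structures.
From mathcomp Require Import all_boot all_order all_algebra.
From mathcomp Require Import reals trigo.

Set Implicit Arguments.
Unset Strict Implicit.
Unset Printing Implicit Defensive.

Import Order.TTheory GRing.Theory Num.Theory.

Local Open Scope ring_scope.

(* The ordinal v : 'I_N stands for the vertex labelled v + 1. *)
Definition loose_edge (m s n i : nat) : {set 'I_(n * (m - s))} :=
  [set v : 'I_(n * (m - s)) |
     [exists k : 'I_m, v.+1 == i * (m - s) + k.+1 %[mod n * (m - s)]]]%N.

(* A hypergraph on 'I_N is given by its set of edges, so repeated edges would
   be identified. The edges below are n distinct m-sets when 0 < s,
   2 * s <= m and 1 < n, except that the two edges coincide when
   n = 2 and m = 2 * s. *)
Definition loose_cycle (m s n : nat) : {set {set 'I_(n * (m - s))}} :=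
  [set loose_edge m s n i | i : 'I_n].

Definition adjacency_mx (R : realType) (N m : nat) (E : {set {set 'I_N}}) :
    'M[R]_N :=
  \matrix_(u, v) if u == v then 0
    else (m%:R - 1)^-1 * #|[set e in E | (u \in e) && (v \in e)]|%:R.

(* l lists all the eigenvalues of A, repeated according to multiplicity. *)
Definition spectrum_is (R : realType) (N : nat) (A : 'M[R]_N) (l : seq R) :
    Prop :=
  char_poly A = \prod_(x <- l) ('X - x%:P).

Definition eigen_mult (R : realType) (N : nat) (A : 'M[R]_N) (x : R) : nat :=
  mup x (char_poly A).

Definition cos_frac (R : realType) (n i : nat) : R :=
  cos (2 * pi * i%:R / n%:R).

(* gamma_plus and gamma_minus are the two roots of
     x^2 - (m - 3 + 2 s c) x - 2 (m - s - 1 + s c),   c = cos (2 pi i / n).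
   They are eigenvalues of m - 1 times the adjacency matrix. *)
Definition gamma_lin (R : realType) (m s n i : nat) : R :=
  m%:R - 3 + 2 * s%:R * cos_frac R n i.

Definition gamma_disc (R : realType) (m s n i : nat) : R :=
  gamma_lin R m s n i ^+ 2
    + 8 * (m%:R - s%:R - 1 + s%:R * cos_frac R n i).

Definition gamma_plus (R : realType) (m s n i : nat) : R :=
  2^-1 * (gamma_lin R m s n i + Num.sqrt (gamma_disc R m s n i)).

Definition gamma_minus (R : realType) (m s n i : nat) : R :=
  2^-1 * (gamma_lin R m s n i - Num.sqrt (gamma_disc R m s n i)).

(* Main.v *)
Require Import Defs.
From HB Require Import structures.
From mathcomp Require Import all_boot all_order all_algebra.
From mathcomp Require Import reals trigo complex ring lra zify.

Set Implicit Arguments.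
Unset Strict Implicit.
Unset Printing Implicit Defensive.

Import Order.TTheory GRing.Theory Num.Theory.

Local Open Scope ring_scope.

(** Put d = m - s and write a vertex as v = q d + r with r < d. Edge i is the
    whole block q = i together with the first s vertices of the cyclically next
    block. So if B is the vertex-edge incidence matrix and D the diagonal matrix
    of degrees (2 when r < s, 1 otherwise), the edges being pairwise distinct,
    (m - 1) A = B B^T - D ([scaled_adjacencyE]).

    For x > 0 the diagonal matrix x + D is invertible, and the Schur complement
    identity [det_sub_mulmx] moves the determinant of x + D - B B^T from
    vertices to edges: it equals det (x + D) times det (1 - B^T (x + D)^-1 B).
    The second matrix is only n x n, and by the block structure it is a
    combination a + b (P + P^T) of the identity and the cyclic shift P
    ([gram_incidence]). The columns of powers of the n-th roots of unity
    diagonalise it, whence the cosines ([det_cycle_adj_cos]).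

    With c_k = cos (2 pi k / n) and e = d - s, the result ([det_loose_cycle]) is

      ((x + 2)^s (x + 1)^e)^n
        prod_k (1 - 2 s (1 + c_k) / (x + 2) - e / (x + 1)).

    If e = 0, each factor absorbs one factor x + 2 and becomes
    x - 2 (s - 1 + s c_k). If e > 0, it absorbs (x + 1) (x + 2) and becomes the
    quadratic whose roots are gamma_plus and gamma_minus. Both sides being
    polynomials in x, agreement for x > 0 determines the characteristic
    polynomial ([spectrum_is_scaled]), and the multiplicities are read off its
    factorisation. *)

(** * Determinants and characteristic polynomials *)

(** Both sides are the determinant of the block matrix with rows (T, B) and
    (C, 1), factored through the Schur complement of either diagonal block. *)
Lemma det_sub_mulmx (R : comPzRingType) (p q : nat) (T T' : 'M[R]_p)
    (B : 'M[R]_(p, q)) (C : 'M[R]_(q, p)) :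
  T *m T' = 1%:M ->
  \det (T - B *m C) = \det T * \det (1%:M - C *m T' *m B).
Proof.
move=> TT'; set S := 1%:M - _.
have schur_ul : block_mx T B C 1%:M =
    block_mx 1%:M B 0 1%:M *m block_mx (T - B *m C) 0 C 1%:M.
  by rewrite mulmx_block !mul1mx !mul0mx !mulmx1 !add0r subrK.
have schur_dr : block_mx T B C 1%:M =
    block_mx T 0 C 1%:M *m block_mx 1%:M (T' *m B) 0 S.
  rewrite mulmx_block !mulmx1 !mul1mx !mul0mx ?mulmx0 !addr0 mulmxA TT'.
  by rewrite mul1mx mulmxA /S addrC subrK.
have := congr1 (@determinant _ _) schur_ul; rewrite schur_dr !det_mulmx.
by rewrite !det_lblock !det_ublock !det1 !mulr1 !mul1r.
Qed.

(** The positive integers already give more common values than the degree. *)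
Lemma poly_eq_pos (R : numFieldType) (p q : {poly R}) :
  (forall t : R, 0 < t -> p.[t] = q.[t]) -> p = q.
Proof.
move=> pq; apply/eqP; rewrite -subr_eq0; apply/eqP.
apply: (@roots_geq_poly_eq0 _ _ [seq k.+1%:R | k <- iota 0 (size (p - q))]).
- apply/allP=> _ /mapP[k _ ->]; rewrite rootE hornerD hornerN pq ?subrr //.
- by rewrite map_inj_uniq ?iota_uniq // => i j /eqP; rewrite eqr_nat => /eqP[].
- by rewrite size_map size_iota.
Qed.

Lemma horner_char_poly (R : comNzRingType) (n : nat) (A : 'M[R]_n) (t : R) :
  (char_poly A).[t] = \det (t%:M - A).
Proof.
rewrite -horner_evalE /char_poly -det_map_mx; congr (\det _).
apply/matrixP=> i j; rewrite !mxE /= /horner_eval.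
by case: eqP; rewrite !hornerE.
Qed.

(** Stating the hypothesis for c A and only for x > 0 allows dividing by the
    shifted degrees x + 1 and x + 2 without rational functions. *)
Lemma spectrum_is_scaled (R : realType) (N : nat) (A : 'M[R]_N) (c : R)
    (l : seq R) :
  0 < c -> size l = N ->
  (forall x, 0 < x -> \det (x%:M - c *: A) = \prod_(y <- l) (x - y)) ->
  spectrum_is A [seq y / c | y <- l].
Proof.
move=> c0 sl detA; apply: poly_eq_pos => t t0.
have cN0 : c != 0 by rewrite gt_eqF.
rewrite horner_char_poly big_map horner_prod.
apply: (@mulfI _ (c ^+ N)); first by rewrite expf_neq0.
rewrite -detZ scalerBr scale_scalar_mx detA ?mulr_gt0 //.
have -> : c ^+ N = \prod_(y <- l) c.
  by rewrite big_const_seq iter_mulr_1 count_predT sl.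
rewrite -big_split /=.
by apply: eq_bigr => y _; rewrite !hornerE mulrBr mulrCA divff ?mulr1.
Qed.

(** * Sums over blocks of vertices *)

Lemma big_ord_divmod (T : Type) (idx : T) (op : Monoid.law idx) (n d : nat)
    (F : nat -> nat -> T) :
  \big[op/idx]_(v < n * d) F (v %/ d)%N (v %% d)%N =
  \big[op/idx]_(q < n) \big[op/idx]_(r < d) F q r.
Proof.
rewrite -(big_mkord xpredT (fun v => F (v %/ d)%N (v %% d)%N)) big_nat_mul.
rewrite big_mkord; apply: eq_bigr => q _.
rewrite -{1}[(q * d)%N]add0n big_addn mulSn addnK big_mkord.
apply: eq_bigr => r _; have d0 := leq_ltn_trans (leq0n r) (ltn_ord r).
by rewrite addnC divnMDl ?modnMDl ?modn_small ?divn_small ?addn0.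
Qed.

(** Sums over one block, whose first s vertices are the shared ones. *)
Lemma big_ord_lt (T : Type) (idx : T) (op : Monoid.law idx) (s e : nat)
    (F : bool -> T) :
  \big[op/idx]_(r < s + e) F (r < s)%N =
  op (\big[op/idx]_(r < s) F true) (\big[op/idx]_(r < e) F false).
Proof.
rewrite big_split_ord; congr (op _ _); apply: eq_bigr => r _ /=.
  by rewrite ltn_ord.
by rewrite ltnNge leq_addr.
Qed.

Lemma sum_pick (R : pzSemiRingType) (n : nat) (k : 'I_n) (f : nat -> R) :
  \sum_(q < n) (q == k :> nat)%:R * f q = f k.
Proof.
rewrite (bigD1 k) //= eqxx mul1r big1 ?addr0 // => q.
by rewrite -val_eqE /= => /negPf->; rewrite mul0r.
Qed.

(** * The determinant of a combination of the identity and the cycle graph *)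

(** This is what makes exp (2 pi i / n) a primitive root of unity: a smaller
    power would have real part 1. With t half the angle, cos (2 t) is
    1 - 2 sin^2 t and 0 < t < pi. *)
Lemma cos_frac_lt1 (R : realType) (n k : nat) :
  (0 < k < n)%N -> cos_frac R n k < 1.
Proof.
case/andP=> k0 kn; set t : R := pi * k%:R / n%:R.
have n0 : (0 < n)%N by exact: ltn_trans kn.
have -> : cos_frac R n k = cos (t *+ 2).
  by rewrite -[t *+ 2]mulr_natl /t /cos_frac !mulrA.
have : 0 < sin t.
  apply: sin_gt0_pi; rewrite divr_gt0 ?mulr_gt0 ?pi_gt0 ?ltr0n //=.
  by rewrite ltr_pdivrMr ?ltr0n // ltr_pM2l ?pi_gt0 // ltr_nat.
move=> st; rewrite cos_mulr2n cos2sin2.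
by rewrite -subr_gt0; have := exprn_gt0 2 st; lra.
Qed.

Lemma cos_frac_period (R : realType) (n : nat) :
  (0 < n)%N -> cos_frac R n n = cos_frac R n 0.
Proof.
move=> n0; rewrite /cos_frac mulfK ?pnatr_eq0 -?lt0n //.
by rewrite mulr0 mul0r cos0 mulr_natl cos2pi.
Qed.

(** The sum P + P^T for P the cyclic shift. Summing rather than taking a
    union gives off-diagonal entries 2 when n = 2: each of the two edges of the
    loose cycle then shares s vertices with the other at both of its ends. *)
Definition cycle_adj (R : pzRingType) (n : nat) : 'M[R]_n :=
  \matrix_(i, j) ((i == ordS j)%:R + (ordS i == j)%:R).

(** The column of powers of an n-th root of unity is an eigenvector: the two
    cyclic neighbours of i contribute z^(i+1) and z^(i-1). *)
Lemma cycle_adj_powers (K : fieldType) (n : nat) (z : K) (i : 'I_n) :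
  z ^+ n = 1 ->
  \sum_(j < n) cycle_adj K n i j * z ^+ j = z ^+ i * (z + z^-1).
Proof.
move=> zn; have n0 : (0 < n)%N by exact: leq_ltn_trans (ltn_ord i).
have z0 : z != 0.
  apply: contra_eq_neq zn => ->.
  by rewrite expr0n gtn_eqF // eq_sym oner_neq0.
have zS (j : 'I_n) : z ^+ ordS j = z ^+ j.+1 by rewrite /= expr_mod.
under eq_bigr => j _ do rewrite mxE mulrDl.
rewrite big_split /= mulrDr addrC; congr (_ + _).
  rewrite (bigD1 (ordS i)) //= eqxx mul1r big1 ?addr0 => [|j /negPf ji].
    by rewrite zS exprSr.
  by rewrite eq_sym ji mul0r.
rewrite (bigD1 (ord_pred i)) //= ord_predK eqxx mul1r big1 ?addr0; last first.
  move=> j ji; case: (i =P ordS j) ji => [->|_ _]; last by rewrite mul0r.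
  by rewrite ordSK eqxx.
by rewrite -{2}(ord_predK i) zS exprSr mulfK.
Qed.

(** The eigenvectors given by the powers of w form a Vandermonde matrix, which
    is invertible because these powers are distinct. *)
Lemma det_cycle_adj (K : fieldType) (n : nat) (w : K) (a b : K) :
  n.-primitive_root w ->
  \det (a%:M + b *: cycle_adj K n) =
    \prod_(k < n) (a + b * (w ^+ k + (w ^+ k)^-1)).
Proof.
move=> w_prim; pose V := Vandermonde n (\row_(k < n) w ^+ k).
have wk1 k : (w ^+ k) ^+ n = 1.
  by rewrite -exprM mulnC exprM (prim_expr_order w_prim) expr1n.
have detV : \det V != 0.
  rewrite det_Vandermonde; apply/prodf_neq0 => i _; apply/prodf_neq0 => j ij.
  rewrite !mxE subr_eq0 (eq_prim_root_expr w_prim) !modn_small //.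
  by rewrite gtn_eqF.
have AV : (a%:M + b *: cycle_adj K n) *m V =
    V *m diag_mx (\row_(k < n) (a + b * (w ^+ k + (w ^+ k)^-1))).
  apply/matrixP=> i k; rewrite mul_mx_diag mulmxDl mul_scalar_mx -scalemxAl.
  rewrite !mxE; under eq_bigr => j _ do rewrite [V _ _]mxE [X in _ * X ^+ _]mxE.
  by rewrite cycle_adj_powers //; ring.
apply: (mulIf detV); rewrite -det_mulmx AV det_mulmx mulrC; congr (_ * _).
by rewrite det_diag; apply: eq_bigr => k _; rewrite mxE.
Qed.

Local Open Scope complex_scope.

Definition cis (R : realType) (t : R) : R[i] := cos t +i* sin t.

Lemma cis_exp (R : realType) (t : R) (k : nat) :
  cis t ^+ k = cis (t * k%:R).
Proof.
elim: k => [|k IHk]; first by rewrite mulr0 /cis cos0 sin0 expr0.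
rewrite exprS IHk -natr1 mulrDr mulr1 addrC /cis cosD sinD; apply/eqP.
by rewrite eq_complex /= eqxx /= addrC.
Qed.

Lemma cisV (R : realType) (t : R) : (cis t)^-1 = cos t -i* sin t.
Proof.
have cs : cis t * (cos t -i* sin t) = 1.
  apply/eqP; rewrite eq_complex /= -!expr2 !mulrN opprK.
  by rewrite cos2Dsin2 [sin t * _]mulrC addNr !eqxx.
have c0 : cis t != 0.
  by apply: contra_eq_neq cs => ->; rewrite mul0r eq_sym oner_neq0.
by rewrite -[LHS]mulr1 -cs mulKf.
Qed.

Lemma cis_primitive (R : realType) (n : nat) :
  (0 < n)%N -> n.-primitive_root (cis (2 * pi / n%:R : R)).
Proof.
move=> n0; set w := cis _.
have wE k : w ^+ k = cis (2 * pi * k%:R / n%:R) by rewrite cis_exp mulrAC.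
have wn : w ^+ n = 1.
  by rewrite wE mulfK ?pnatr_eq0 -?lt0n // mulr_natl /cis cos2pi sin2pi.
(* w has some order d dividing n; d < n would give cos (2 pi d / n) = 1 *)
have [d w_prim dn] := prim_order_exists n0 wn.
suff <- : d = n by [].
apply/eqP; rewrite eqn_leq dvdn_leq //= leqNgt; apply/negP => dn'.
have := @cos_frac_lt1 R n d; rewrite (prim_order_gt0 w_prim) dn' => /(_ isT).
have := prim_expr_order w_prim; rewrite wE => /(congr1 (@complex.Re R)) /= cos1.
by rewrite /cos_frac cos1 ltxx.
Qed.

(** The factors are computed over the complex numbers; both sides being real,
    the identity descends. The index range 1..n replaces 0..n-1 by
    periodicity. *)
Lemma det_cycle_adj_cos (R : realType) (n : nat) (a b : R) :
  \det (a%:M + b *: cycle_adj R n) =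
    \prod_(1 <= k < n.+1) (a + b * (2 * cos_frac R n k)).
Proof.
case: n => [|n]; first by rewrite det_mx00 big_geq.
transitivity (\prod_(k < n.+1) (a + b * (2 * cos_frac R n.+1 k))).
  apply: complexI.
  rewrite -det_map_mx rmorph_prod map_mxD map_scalar_mx map_mxZ.
  have -> : map_mx (real_complex R) (cycle_adj R n.+1) = cycle_adj R[i] n.+1.
    by apply/matrixP=> i j; rewrite !mxE rmorphD !rmorph_nat.
  rewrite (det_cycle_adj _ _ (cis_primitive R (ltn0Sn n))).
  apply: eq_bigr => k _; rewrite rmorphD rmorphM; congr (_ + _ * _).
  rewrite cis_exp mulrAC cisV; apply/eqP; rewrite eq_complex /= addrN.
  by rewrite eqxx andbT; apply/eqP; rewrite /cos_frac; ring.
rewrite big_ord_recl -(cos_frac_period R (ltn0Sn n)) mulrC.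
by rewrite big_add1 big_nat_recr //= big_mkord.
Qed.

Local Close Scope complex_scope.

(** * The loose cycle through its incidence matrix *)

(** With v = q d + r, the vertex v is the r-th one of block q; edge i consists
    of block i and of the first s vertices of the next block. *)
Definition incident (s d n v i : nat) : bool :=
  (v %/ d == i)%N || ((v %/ d == i.+1 %% n) && (v %% d < s))%N.

(** The k-th vertex of edge i, for 0 <= k < m = d + s, has label i d + k modulo
    n d. Since s <= d, the quotient of k by d is 0 or 1, and it is 1 exactly
    when k = d + r with r < s. *)
Lemma mem_loose_edge (m s n i : nat) (v : 'I_(n * (m - s))) :
  (s <= m - s)%N -> (i < n)%N ->
  (v \in loose_edge m s n i) = incident s (m - s) n v i.
Proof.
rewrite inE /incident; move: v => [v /=]; set d := (m - s)%N => vN sd i_n.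
have mE : m = (d + s)%N by rewrite /d in sd *; lia.
have d0 : (0 < d)%N by case: (d) vN => //; rewrite muln0.
have shift k :
    (v.+1 == i * d + k.+1 %[mod n * d]) = (v == (i * d + k) %% (n * d))%N.
  by rewrite -addn1 -[k.+1]addn1 addnA eqn_modDr modn_small.
apply/existsP/idP => [[[k /= km]]|].
  rewrite shift => /eqP ->; rewrite -modn_divl (modn_dvdm _ (dvdn_mull _ _)) //.
  rewrite divnMDl // modnMDl; have [kd|dk] := ltnP k d.
    by rewrite (divn_small kd) addn0 modn_small // eqxx.
  have kr : (k - d < s)%N by lia.
  have krd := leq_trans kr sd.
  rewrite -(subnKC dk) divnDl // divnn d0 modnDl addnA addn1.
  by rewrite (divn_small krd) (modn_small krd) addn0 eqxx kr orbT.
have rd : (v %% d < d)%N by rewrite ltn_mod.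
case/orP=> [/eqP vi|/andP[/eqP vi rs]].
  have km : (v %% d < m)%N by lia.
  by exists (Ordinal km); rewrite shift /= -vi -divn_eq modn_small.
have km : (d + v %% d < m)%N by lia.
exists (Ordinal km); rewrite shift /= addnA -mulSnr -modnDml -muln_modl -vi.
by rewrite -divn_eq modn_small.
Qed.

(** If 2 s < m, the vertex of block i at position s, counted from 0, belongs to
    edge i alone. If m = 2 s, the vertex of block i at position 0 belongs only
    to edge i and to the preceding one. So if i and j give the same edge but
    differ, each is the successor of the other; i = i + 2 modulo n is excluded
    by n > 2. *)
Lemma loose_edge_inj (m s n : nat) :
  (0 < s <= m - s)%N -> (1 < n)%N -> (2 * s < m)%N || (2 < n)%N ->
  injective (fun i : 'I_n => loose_edge m s n i).
Proof.
move=> /andP[s0 sd] n1 mn i j /= ij; set d := (m - s)%N in sd *.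
have d0 : (0 < d)%N by exact: leq_trans sd.
have incE v : (v < n * d)%N -> incident s d n v i = incident s d n v j.
  move=> vN; have E k := @mem_loose_edge m s n k (Ordinal vN) sd.
  by rewrite -!E ?ij ?ltn_ord.
have vN (q : 'I_n) r : (r < d)%N -> (q * d + r < n * d)%N.
  move=> rd; apply: (@leq_trans (q.+1 * d)%N).
    by rewrite mulSnr ltn_add2l.
  by rewrite leq_mul2r ltn_ord orbT.
have inc q r k : (r < d)%N ->
    incident s d n (q * d + r) k = (q == k) || (q == k.+1 %% n)%N && (r < s)%N.
  move=> rd.
  by rewrite /incident divnMDl // modnMDl divn_small ?(modn_small rd) ?addn0.
case/orP: mn => [ms|n2].
  have rd : (s < d)%N by rewrite /d; lia.
  have := incE _ (vN i _ rd); rewrite !inc // ltnn !andbF !orbF eqxx.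
  by move=> /esym/eqP/val_inj.
have := incE _ (vN i _ d0); have := incE _ (vN j _ d0).
rewrite !inc // s0 !andbT !eqxx /= => /orP[/eqP/val_inj//|/eqP ji].
move=> /esym/orP[/eqP/val_inj//|/eqP]; rewrite ji.
have [i1|i1] := ltnP i.+1 n; last first.
  have -> : i.+1 = n by apply/eqP; rewrite eqn_leq i1 ltn_ord.
  rewrite modnn modn_small //; have := ltn_ord i; lia.
rewrite (modn_small i1).
have [i2|i2] := ltnP i.+2 n; first by rewrite modn_small //; lia.
have -> : i.+2 = n by apply/eqP; rewrite eqn_leq i2 i1.
by rewrite modnn; lia.
Qed.

Definition incidence_mx (R : pzRingType) (s d n : nat) : 'M[R]_(n * d, n) :=
  \matrix_(v, i) (incident s d n v i)%:R.

Definition degree_mx (R : pzRingType) (s d n : nat) : 'M[R]_(n * d) :=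
  diag_mx (\row_v (1 + (v %% d < s))%N%:R).

(** The two alternatives exclude each other because a block is not its own
    successor when n > 1. *)
Lemma incidentE (R : pzSemiRingType) (s d n v : nat) (i : 'I_n) : (1 < n)%N ->
  (incident s d n v i)%:R =
    (v %/ d == i)%N%:R + (v %/ d == ordS i)%N%:R * (v %% d < s)%N%:R :> R.
Proof.
move=> n1; rewrite /incident /=; case: (_ =P _ :> nat) => [->|_] /=; last first.
  by rewrite add0r -natrM mulnb.
suff -> : (i == i.+1 %% n :> nat)%N = false by rewrite mul0r addr0.
have [i1|i1] := ltnP i.+1 n; first by rewrite modn_small //; lia.
have -> : i.+1 = n by apply/eqP; rewrite eqn_leq i1 ltn_ord.
by rewrite modnn; lia.
Qed.

(** Off the diagonal, (B B^T) u v counts the edges through u and v, since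
    distinct indices give distinct edges; on the diagonal it is the degree
    of u. *)
Lemma scaled_adjacencyE (R : realType) (m s n : nat) :
  (0 < s <= m - s)%N -> (1 < n)%N -> (2 * s < m)%N || (2 < n)%N ->
  let B := incidence_mx R s (m - s) n in
  (m%:R - 1) *: adjacency_mx R m (loose_cycle m s n) =
    B *m B^T - degree_mx R s (m - s) n.
Proof.
move=> sd n1 mn B; have m1 : m%:R - 1 != 0 :> R.
  by rewrite subr_eq0 pnatr_eq1; lia.
have [s0 sd'] := andP sd.
have uv_edges u v : #|[set e in loose_cycle m s n | (u \in e) && (v \in e)]|%:R
    = (B *m B^T) u v.
  rewrite /loose_cycle; set f := fun i : 'I_n => loose_edge m s n i.
  transitivity (#|[set i | (u \in f i) && (v \in f i)]|%:R : R).
    rewrite -(card_imset _ (loose_edge_inj sd n1 mn)).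
    congr (#|pred_of_set _|%:R).
    apply/setP=> e; rewrite inE; apply/andP/imsetP => [[/imsetP[i _ ->] uv]|].
      by exists i => //; rewrite in_set.
    by case=> i; rewrite inE => uv ->; rewrite imset_f.
  rewrite -sum1_card natr_sum big_mkcond mxE; apply: eq_bigr => i _.
  rewrite !mxE inE -!(mem_loose_edge _ sd') // -natrM mulnb.
  by rewrite -/(f i); case: (_ && _).
apply/matrixP=> u v; rewrite mxE [adjacency_mx _ _ _ _ _]mxE uv_edges.
have -> : (B *m B^T - degree_mx R s (m - s) n) u v =
    (B *m B^T) u v - (1 + (u %% (m - s) < s))%N%:R *+ (u == v).
  by rewrite mxE; congr (_ + _); rewrite !mxE.
case: eqP => [<-|_]; last by rewrite mulVKf // subr0.
apply/eqP; rewrite mulr0 mulr1n eq_sym subr_eq0; apply/eqP.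
transitivity (\sum_(i < n) (incident s (m - s) n u i)%:R : R).
  by rewrite mxE; apply: eq_bigr => i _; rewrite !mxE -natrM mulnb andbb.
under eq_bigr do rewrite incidentE //.
rewrite big_split /= -mulr_suml natrD; set q := (u %/ (m - s))%N.
have qn : (q < n)%N.
  by rewrite ltn_divLR ?(leq_trans s0) //; exact: ltn_ord.
have sum1 : \sum_(i < n) (q == i)%N%:R = 1 :> R.
  rewrite (bigD1 (Ordinal qn)) //= eqxx big1 ?addr0 // => i.
  by rewrite -val_eqE eq_sym /= => /negPf->.
by rewrite -(reindex _ (onW_bij _ (@ordS_bij n)) (P := xpredT)
   (F := fun i : 'I_n => (q == i)%N%:R)) sum1 mul1r.
Qed.

(** * The characteristic determinant of the loose cycle *)

(** The entry of B^T W B for a diagonal weight W equal to a on the s shared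
    vertices of each block and to b on the e others. The shared vertices of a
    block join its edge with the preceding one. *)
Lemma gram_incidence (R : comPzRingType) (s e n : nat) (a b : R) (i j : 'I_n) :
  (1 < n)%N ->
  \sum_(v < n * (s + e)) (incident s (s + e) n v i)%:R
      * (if (v %% (s + e) < s)%N then a else b)
      * (incident s (s + e) n v j)%:R =
  ((2 * s%:R * a + e%:R * b)%:M + (s%:R * a) *: cycle_adj R n) i j.
Proof.
move=> n1; under eq_bigr do rewrite !incidentE //.
pose G (q : nat) (t : bool) : R :=
  ((q == i :> nat)%:R + (q == ordS i :> nat)%:R * t%:R)
  * (if t then a else b)
  * ((q == j :> nat)%:R + (q == ordS j :> nat)%:R * t%:R).
rewrite (big_ord_divmod _ n (s + e) (fun q r => G q (r < s)%N)).
(* g and h collect what block q contributes as the block of edge i and as the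
   next one; the latter involves shared vertices only *)
pose h (q : nat) : R :=
  s%:R * a * ((q == j :> nat)%:R + (q == ordS j :> nat)%:R).
pose g (q : nat) : R := h q + e%:R * b * (q == j :> nat)%:R.
transitivity (\sum_(q < n) ((q == i :> nat)%:R * g q
    + (q == ordS i :> nat)%:R * h q)).
  apply: eq_bigr => q _; rewrite big_ord_lt !sumr_const !card_ord /g /h /G /=.
  rewrite -[true%:R]/1 -[false%:R]/0.
  by rewrite -[_ *+ s]mulr_natl -[_ *+ e]mulr_natl; ring.
rewrite big_split sum_pick (sum_pick (ordS i)) /g /h !mxE !val_eqE.
by rewrite (inj_eq (@ordS_inj n)) -[_ *+ (i == j)]mulr_natr /=; ring.
Qed.

(** Each block has s vertices of degree 2 and e of degree 1, so that the
    prefactor is det (x + D); the product is the determinant over the edges. *)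
Lemma det_loose_cycle (R : realType) (s d e n : nat) (x : R) :
  d = (s + e)%N -> (1 < n)%N -> 0 < x ->
  let B := incidence_mx R s d n in
  \det (x%:M - (B *m B^T - degree_mx R s d n)) =
    ((x + 2) ^+ s * (x + 1) ^+ e) ^+ n *
    \prod_(1 <= k < n.+1)
      (1 - 2 * s%:R / (x + 2) * (1 + cos_frac R n k) - e%:R / (x + 1)).
Proof.
move=> -> n1 x0 B; set d' := (s + e)%N.
have x1N0 : x + 1 != 0 by rewrite gt_eqF // addr_gt0.
have x2N0 : x + 2 != 0 by rewrite gt_eqF // addr_gt0.
pose w (t : bool) : R := if t then x + 2 else x + 1.
have wN0 t : w t != 0 by case: t.
pose diag f : 'M[R]_(n * d') := diag_mx (\row_v f (v %% d' < s)%N).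
have -> : x%:M - (B *m B^T - degree_mx R s d' n) = diag w - B *m B^T.
  rewrite opprB addrA; congr (_ - _); apply/matrixP=> u v.
  rewrite !mxE -mulrnDl /w; case: (u == v); last by rewrite !mulr0n.
  by rewrite !mulr1n; case: (_ < s)%N.
rewrite (@det_sub_mulmx _ _ _ _ (diag (fun t => (w t)^-1))); last first.
  apply/matrixP=> u v; rewrite mul_diag_mx !mxE; case: eqP => _.
    by rewrite !mulr1n divff.
  by rewrite !mulr0n mulr0.
congr (_ * _).
  rewrite det_diag; under eq_bigr do rewrite mxE.
  rewrite (big_ord_divmod _ n d' (fun _ r => w (r < s)%N)).
  by rewrite prodr_const card_ord big_ord_lt /= !prodr_const !card_ord.
pose a : R := (x + 2)^-1; pose b : R := (x + 1)^-1.
transitivity (\det ((1 - (2 * s%:R * a + e%:R * b))%:M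
                     + (- (s%:R * a)) *: cycle_adj R n)).
  congr (\det _); apply/matrixP=> i j.
  transitivity ((1%:M - ((2 * s%:R * a + e%:R * b)%:M
                 + (s%:R * a) *: cycle_adj R n)) i j); last first.
    by rewrite scaleNr opprD addrA raddfB.
  have subE (X Y : 'M[R]_n) : (X - Y) i j = X i j - Y i j by rewrite !mxE.
  rewrite !subE -gram_incidence //; congr (_ - _).
  rewrite mul_mx_diag mxE; apply: eq_bigr => v _; rewrite !mxE /w.
  by case: (v %% d' < s)%N.
rewrite det_cycle_adj_cos; apply: eq_bigr => k _.
by rewrite /a /b; ring.
Qed.

(** * The two spectra *)

(** Since cos >= -1, m - s - 1 + s cos >= m - 2 s - 1 >= 0. *)
Lemma gamma_disc_ge0 (R : realType) (m s n i : nat) :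
  (2 * s + 1 <= m)%N -> 0 <= gamma_disc R m s n i.
Proof.
rewrite -(ler_nat R) natrD natrM => sm; rewrite /gamma_disc.
have /(ler_wpM2l (ler0n R s)) sc : -1 <= cos_frac R n i by exact: cos_geN1.
by apply: addr_ge0; [exact: sqr_ge0 | lra].
Qed.

(** Nonnegativity of the discriminant lets the square root be squared back. *)
Lemma gamma_factor (R : realType) (m s n i : nat) (x : R) :
  (2 * s + 1 <= m)%N ->
  (x - gamma_plus R m s n i) * (x - gamma_minus R m s n i) =
  x ^+ 2 - gamma_lin R m s n i * x
    - 2 * (m%:R - s%:R - 1 + s%:R * cos_frac R n i).
Proof.
move=> /(gamma_disc_ge0 R n i)/sqr_sqrtr; rewrite /gamma_plus /gamma_minus.
rewrite {2}/gamma_disc; move: (Num.sqrt _) (gamma_lin _ _ _ _ _) => r l.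
move=> rE; transitivity ((x - l / 2) ^+ 2 - r ^+ 2 / 4); first by field.
by rewrite rE; field.
Qed.

Lemma prod_nseq (R : pzSemiRingType) (T : Type) (k : nat) (y : T) (f : T -> R) :
  \prod_(z <- nseq k y) f z = f y ^+ k.
Proof. by rewrite big_nseq iter_mulr_1. Qed.

Lemma prod_const_1n (R : pzSemiRingType) (n : nat) (x : R) :
  x ^+ n = \prod_(1 <= k < n.+1) x.
Proof. by rewrite prodr_const_nat subn1. Qed.

(** Here every vertex has degree 2: out of the s factors x + 2 of each block,
    one clears the denominator of the corresponding cosine factor and s - 1 give the
    eigenvalue - 2. *)
Lemma spectrum_2s (R : realType) (s n : nat) :
  (0 < s)%N -> (2 < n)%N ->
  spectrum_is (adjacency_mx R (2 * s) (loose_cycle (2 * s) s n))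
    [seq y / ((2 * s)%:R - 1) |
       y <- nseq (n * (s - 1)) (- 2)
         ++ [seq 2 * (s%:R - 1 + s%:R * cos_frac R n i)
              | i <- index_iota 1 n.+1]].
Proof.
move=> s0 n2; have dE : (2 * s - s)%N = (s + 0)%N by lia.
apply: spectrum_is_scaled => [||x x0].
- by rewrite subr_gt0 ltr1n; lia.
- by rewrite size_cat size_nseq size_map size_iota dE; nia.
have x2 : x + 2 != 0 by rewrite gt_eqF // addr_gt0.
rewrite scaled_adjacencyE ?s0 ?n2 ?orbT //=; try lia.
rewrite (det_loose_cycle dE) ?(ltnW n2) //.
rewrite expr0 mulr1 big_cat big_map prod_nseq opprK /= [(n * _)%N]mulnC exprM.
have -> : (x + 2) ^+ s = (x + 2) ^+ (s - 1) * (x + 2).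
  by rewrite -exprSr subn1 prednK.
rewrite exprMn -[LHS]mulrA; congr (_ * _).
rewrite (prod_const_1n n) -big_split; apply: eq_bigr => k _ /=.
by rewrite mul0r subr0; field.
Qed.

(** Each cosine factor takes one x + 1 and one x + 2 from its block, and becomes
    the quadratic of gamma_plus and gamma_minus; what is left of the block gives
    the eigenvalues - 1 and - 2. *)
Lemma spectrum_ge2s1 (R : realType) (m s n : nat) :
  (0 < s)%N -> (2 * s + 1 <= m)%N -> (1 < n)%N ->
  spectrum_is (adjacency_mx R m (loose_cycle m s n))
    [seq y / (m%:R - 1) |
       y <- nseq (n * (m - 2 * s - 1)) (- 1) ++ nseq (n * (s - 1)) (- 2)
         ++ [seq gamma_plus R m s n i | i <- index_iota 1 n.+1]
         ++ [seq gamma_minus R m s n i | i <- index_iota 1 n.+1]].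
Proof.
(* e is one less than the number m - 2 s of vertices of degree 1 in a block *)
move=> s0 sm n1; set e := (m - 2 * s - 1)%N.
have dE : (m - s)%N = (s + e.+1)%N by rewrite /e; lia.
have mE : m%:R = s%:R + s%:R + e%:R + 1 :> R.
  by rewrite -!natrD natr1; congr _%:R; rewrite /e; lia.
apply: spectrum_is_scaled => [||x x0].
- by rewrite subr_gt0 ltr1n; lia.
- by rewrite !size_cat !size_nseq !size_map !size_iota dE; nia.
have x1 : x + 1 != 0 by rewrite gt_eqF // addr_gt0.
have x2 : x + 2 != 0 by rewrite gt_eqF // addr_gt0.
rewrite scaled_adjacencyE //; try lia.
rewrite (det_loose_cycle dE) //.
rewrite !big_cat !big_map !prod_nseq !opprK /= -big_split /=.
rewrite ![(n * _)%N]mulnC !exprM [RHS]mulrA -exprMn.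
have -> : (x + 2) ^+ s * (x + 1) ^+ e.+1 =
    (x + 1) ^+ e * (x + 2) ^+ (s - 1) * ((x + 1) * (x + 2)).
  by rewrite -[in LHS](prednK s0) -subn1 !exprSr; ring.
rewrite [X in X * _ = _]exprMn -[LHS]mulrA; congr (_ * _).
rewrite (prod_const_1n n) -big_split; apply: eq_bigr => k _ /=.
by rewrite gamma_factor // /gamma_lin mE -[e.+1%:R]natr1; field; rewrite x1 x2.
Qed.

Lemma eigen_mult_spectrum (R : realType) (N : nat) (A : 'M[R]_N) (l : seq R) x :
  spectrum_is A l -> eigen_mult A x = count_mem x l.
Proof. by rewrite /eigen_mult => ->; exact: mu_prod_XsubC. Qed.

Theorem theorem4p2p2 (R : realType) (m s n : nat) (s_gt0 : (0 < s)%N) :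
  let A := adjacency_mx R m (loose_cycle m s n) in
  (m = (2 * s)%N -> (2 < n)%N ->
     spectrum_is A
       (nseq (n * (s - 1))%N (- 2 / (2 * s%:R - 1))
        ++ [seq 2 / (2 * s%:R - 1) * (s%:R - 1 + s%:R * cos_frac R n i)
             | i <- index_iota 1 n.+1]))
  /\
  ((2 * s + 1 <= m)%N -> (1 < n)%N ->
     [/\ spectrum_is A
           (nseq (n * (m - 2 * s - 1))%N (- 1 / (m%:R - 1))
            ++ nseq (n * (s - 1))%N (- 2 / (m%:R - 1))
            ++ [seq gamma_plus R m s n i / (m%:R - 1)
                 | i <- index_iota 1 n.+1]
            ++ [seq gamma_minus R m s n i / (m%:R - 1)
                 | i <- index_iota 1 n.+1]),
         (n * (m - 2 * s - 1) <= eigen_mult A (- 1 / (m%:R - 1)))%N,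
         (n * (s - 1) <= eigen_mult A (- 2 / (m%:R - 1)))%N
       & forall i : nat, (1 <= i <= n)%N ->
           (1 <= eigen_mult A (gamma_plus R m s n i / (m%:R - 1)))%N
           /\ (1 <= eigen_mult A (gamma_minus R m s n i / (m%:R - 1)))%N]).
Proof.
move=> A; split=> [mE n2 | sm n1].
  rewrite /A mE; have := spectrum_2s R s_gt0 n2.
  rewrite map_cat map_nseq -map_comp natrM.
  by under eq_map => i do rewrite /= mulrAC.
have := spectrum_ge2s1 R s_gt0 sm n1.
rewrite !map_cat !map_nseq -!map_comp => specA.
split=> [//|||i i_n]; rewrite !(eigen_mult_spectrum _ specA) !count_cat.
- by rewrite count_nseq /= eqxx mul1n leq_addr.
- by rewrite !count_nseq /= eqxx mul1n addnCA leq_addr.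
have i_mem : i \in index_iota 1 n.+1 by rewrite mem_index_iota.
have count_gamma (f : nat -> R) :
    (0 < count_mem (f i) [seq f k | k <- index_iota 1 n.+1])%N.
  by rewrite -has_count has_pred1 map_f.
split; rewrite ltn_addl // ltn_addl //.
  by rewrite ltn_addr // count_gamma.
by rewrite ltn_addl // count_gamma.
Qed.
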